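(* Over a fixed finite alphabet $A$, there is an algorithm that, given an $n$-state complete deterministic finite automaton $\mathcal{A}$, decides in time $O(n)$ whether $L(\mathcal{A})$ obeys the zero-one law (i.e. whether $\lim_{n\to\infty}|L(\mathcal{A})\cap A^n|/|A|^n$ exists and lies in $\{0,1\}$).
   Context: A language $L$ obeys the zero-one law if $\mu(L)=\lim_{n\to\infty}|L\cap A^n|/|A|^n$ exists and equals $0$ or $1$. Automata are complete, deterministic, finite, accessible. *)

(* Defs.v *)
From Stdlib Require Import Reals.
From mathcomp Require Import all_boot.

Set Implicit Arguments.
Unset Strict Implicit.
Unset Printing Implicit Defensive.

Record dfa (k : nat) := DFA {
  nst : nat;
  dinit : 'I_nst;
  delta : 'I_nst -> 'I_k -> 'I_nst;
  dfinal : 'I_nst -> bool }.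

Definition run k (D : dfa k) (w : seq 'I_k) : 'I_(nst D) := foldl (@delta k D) (dinit D) w.

Definition accepts k (D : dfa k) (w : seq 'I_k) : bool := dfinal (run D w).

Definition accessible k (D : dfa k) : Prop :=
  forall q : 'I_(nst D), exists w : seq 'I_k, run D w = q.

Definition count_len k (D : dfa k) (m : nat) : nat :=
  #|[set w : m.-tuple 'I_k | accepts D w]|.

Definition zero_one_law k (D : dfa k) : Prop :=
  exists l : R, (l = R0 \/ l = R1) /\
    Un_cv (fun m => Rdiv (INR (count_len D m)) (pow (INR k) m)) l.

Inductive instr :=
  | IConst (i c : nat)
  | IAdd (i j l : nat)
  | ISub (i j l : nat)          (* mem[i] := mem[j] - mem[l] (truncated) *)
  | ILoad (i j : nat)
  | IStore (i j : nat)
  | IJz (i t : nat)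
  | IJmp (t : nat)
  | IHalt.

Definition program := seq instr.
Definition memory := nat -> nat.

Definition upd (m : memory) (a v : nat) : memory := fun x => if x == a then v else m x.

(* one step from (pc, mem); None = the machine has halted (Halt or pc out of range) *)
Definition step (P : program) (pc : nat) (m : memory) : option (nat * memory) :=
  match nth IHalt P pc with
  | IConst i c => Some (pc.+1, upd m i c)
  | IAdd i j l => Some (pc.+1, upd m i (m j + m l))
  | ISub i j l => Some (pc.+1, upd m i (m j - m l))
  | ILoad i j => Some (pc.+1, upd m i (m (m j)))
  | IStore i j => Some (pc.+1, upd m (m i) (m j))
  | IJz i t => Some (if m i == 0 then t else pc.+1, m)
  | IJmp t => Some (t, m)
  | IHalt => None
  end.

Fixpoint exec (P : program) (t : nat) (pc : nat) (m : memory) : option memory :=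
  match step P pc m with
  | None => Some m
  | Some (pc', m') => if t is t'.+1 then exec P t' pc' m' else None
  end.

(* mem[0] = n, mem[1] = initial state, mem[2+q] = final bit of q (q < n),
   mem[2+n+q*k+a] = delta q a (q < n, a < k), everything else 0. *)
Definition encode k (D : dfa k) : memory := fun x =>
  let n := nst D in
  if x == 0 then n
  else if x == 1 then nat_of_ord (dinit D)
  else if x < n + 2 then
    (match insub (x - 2) : option 'I_n with Some q => nat_of_bool (dfinal q) | None => 0 end)
  else if x < n * k + n + 2 then
    let i := x - 2 - n in
    (match insub (i %/ k) : option 'I_n, insub (i %% k) : option 'I_k with
     | Some q, Some a => nat_of_ord (delta q a)
     | _, _ => 0 end)
  else 0.

(* Main.v *)
Require Import Defs.
From Stdlib Require Import Reals Lra Classical.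
From mathcomp Require Import all_boot.
From mathcomp Require Import zify.

(** Call a state [b]-good if all states reachable from it have final bit [b].
    The zero-one law holds iff for some [b] every state can reach a [b]-good
    state.  If so, the [b]-good states absorb all mass at a geometric rate.  If
    not, some state only reaches states from which the bit [~~ b] is still
    reachable, in bounded time, so that the mass of [~~ b] does not vanish.
    Being [b]-good means not to be backward reachable from the states with bit
    [~~ b]; the criterion thus takes two backward searches for each [b], which
    are linear in the number of edges once the edges are bucketed by target.

    The machine has no free cell of constant address, since the input starts at
    address [0]: the input is first moved above the cell [n * (k + 18)], with
    cells [0] and [1] as the only registers, and the moved input is interleaved
    with the other arrays of the search. *)

Set Implicit Arguments.
Unset Strict Implicit.
Unset Printing Implicit Defensive.

(** * Structured programs and their compilation *)

Inductive cmd (I : Type) :=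
  | Bas of I
  | Seq of cmd I & cmd I
  | If of nat & cmd I & cmd I
  | While of nat & cmd I.

(* [ev c s t s' t']: started in [s] with [t] time credits, [c] ends in [s']
   with [t'] credits left; a basic block or a test costs one credit. *)
Inductive ev (I S : Type) (sem : S -> I -> S) (get : S -> nat -> nat) :
    cmd I -> S -> nat -> S -> nat -> Prop :=
  | EvBas b s t : ev sem get (Bas b) s t.+1 (sem s b) t
  | EvSeq c1 c2 s t s1 t1 s2 t2 : ev sem get c1 s t s1 t1 ->
      ev sem get c2 s1 t1 s2 t2 -> ev sem get (Seq c1 c2) s t s2 t2
  | EvThen r c1 c2 s t s' t' : get s r != 0 ->
      ev sem get c1 s t s' t' -> ev sem get (If r c1 c2) s t.+1 s' t'
  | EvElse r c1 c2 s t s' t' : get s r = 0 ->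
      ev sem get c2 s t s' t' -> ev sem get (If r c1 c2) s t.+1 s' t'
  | EvDone r c s t : get s r = 0 -> ev sem get (While r c) s t.+1 s t
  | EvLoop r c s t s1 t1 s2 t2 : get s r != 0 ->
      ev sem get c s t s1 t1 -> ev sem get (While r c) s1 t1 s2 t2 ->
      ev sem get (While r c) s t.+1 s2 t2.

Definition wp (I S : Type) (sem : S -> I -> S) (get : S -> nat -> nat)
    (c : cmd I) (Q : S -> nat -> Prop) (s : S) (t : nat) : Prop :=
  exists s' t', ev sem get c s t s' t' /\ Q s' t'.

(** * Weakest preconditions with time credits *)

Section Wp.

Variables (I S : Type) (sem : S -> I -> S) (get : S -> nat -> nat).
Implicit Types (c : cmd I) (Q : S -> nat -> Prop).
Local Notation wp := (wp sem get).

Lemma wp_bas b Q s t : 0 < t -> Q (sem s b) t.-1 -> wp (Bas b) Q s t.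
Proof. by case: t => // t _ q; exists (sem s b), t; split=> //; apply: EvBas. Qed.

Lemma wp_seq c1 c2 Q s t : wp c1 (wp c2 Q) s t -> wp (Seq c1 c2) Q s t.
Proof.
move=> [s1 [t1 [E1 [s2 [t2 [E2 q]]]]]].
by exists s2, t2; split=> //; apply: EvSeq E1 E2.
Qed.

Lemma wp_if r c1 c2 Q s t : 0 < t ->
  (get s r != 0 -> wp c1 Q s t.-1) -> (get s r = 0 -> wp c2 Q s t.-1) ->
  wp (If r c1 c2) Q s t.
Proof.
case: t => // t _ H1 H2; have [r0|rN0] := eqVneq (get s r) 0.
  by have [s' [t' [E q]]] := H2 r0; exists s', t'; split=> //; apply: EvElse.
by have [s' [t' [E q]]] := H1 rN0; exists s', t'; split=> //; apply: EvThen.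
Qed.

Lemma ev_credits c s t s' t' : ev sem get c s t s' t' -> t' <= t.
Proof. by elim=> *; lia. Qed.

(* Credits strictly decrease, so the invariant needs no separate variant. *)
Lemma wp_while (Inv : S -> nat -> Prop) r c Q s t :
  (forall s t, Inv s t -> 0 < t) ->
  (forall s t, Inv s t -> get s r = 0 -> Q s t.-1) ->
  (forall s t, Inv s t -> get s r != 0 -> wp c Inv s t.-1) ->
  Inv s t -> wp (While r c) Q s t.
Proof.
move=> Hp Hd Hl; have [m] := ubnP t; elim: m s t => // m IH s [|t] ltm inv.
  by have := Hp _ _ inv.
have [r0|rN0] := eqVneq (get s r) 0.
  by exists s, t; split; [apply: EvDone | apply: (Hd _ _ inv)].
have [s1 [t1 [E1 inv1]]] := Hl _ _ inv rN0.
have [|s2 [t2 [E2 q]]] := IH s1 t1 _ inv1; first by have := ev_credits E1; lia.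
by exists s2, t2; split=> //; apply: EvLoop rN0 E1 E2.
Qed.

End Wp.

(** * Compilation to jumps, and runs of the machine *)

Section Compile.

Variables (I : Type) (cb : I -> program).

(** Jump targets are absolute, so the load address [pc] is passed along. The offset two in the
    targets accounts for the leading [IJz] and the closing [IJmp]. *)
Fixpoint compile (pc : nat) (c : cmd I) : program :=
  match c with
  | Bas b => cb b
  | Seq c1 c2 => let p1 := compile pc c1 in p1 ++ compile (pc + size p1) c2
  | If r c1 c2 =>
      let p1 := compile pc.+1 c1 in
      let p2 := compile (pc + size p1).+2 c2 in
      IJz r (pc + size p1).+2 :: p1 ++ IJmp (pc + size p1 + size p2).+2 :: p2
  | While r c =>
      let p := compile pc.+1 c in IJz r (pc + size p).+2 :: rcons p (IJmp pc)
  end.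

Fixpoint all_cmd (okb : I -> bool) (okr : nat -> bool) (c : cmd I) : bool :=
  match c with
  | Bas b => okb b
  | Seq c1 c2 => all_cmd okb okr c1 && all_cmd okb okr c2
  | If r c1 c2 => [&& okr r, all_cmd okb okr c1 & all_cmd okb okr c2]
  | While r c => okr r && all_cmd okb okr c
  end.

End Compile.

Definition code_at (P : program) (pc : nat) (l : program) : Prop :=
  forall i, i < size l -> nth IHalt P (pc + i) = nth IHalt l i.

Lemma code_at_cat P pc l1 l2 :
  code_at P pc (l1 ++ l2) -> code_at P pc l1 /\ code_at P (pc + size l1) l2.
Proof.
move=> H; split=> i lti.
  by rewrite H ?size_cat ?nth_cat ?lti //; lia.
rewrite -addnA H ?size_cat ?nth_cat; last by lia.
by rewrite ltnNge leq_addr addKn.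
Qed.

Lemma code_at_cons P pc i l :
  code_at P pc (i :: l) -> nth IHalt P pc = i /\ code_at P pc.+1 l.
Proof.
move=> H; split; first by have := H 0 isT; rewrite addn0.
by move=> j ltj; have := H j.+1 ltj; rewrite addnS.
Qed.

Lemma code_at_catl l1 l2 : code_at (l1 ++ l2) 0 l1.
Proof. by move=> i lti; rewrite add0n nth_cat lti. Qed.

Lemma code_at_catr l1 l2 : code_at (l1 ++ l2) (size l1) l2.
Proof. by move=> i lti; rewrite nth_cat ltnNge leq_addr addKn. Qed.

Lemma exec_end P f pc m : size P <= pc -> exec P f pc m = Some m.
Proof. by move=> le; case: f => [|f] /=; rewrite /step nth_default. Qed.

(** Quantifying over the leftover fuel [f] lets runs compose by adding their lengths, without
    mention of halting. *)
Definition steps (P : program) (d pc : nat) (m : memory) (pc' : nat) (m' : memory) :=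
  forall f, exec P (d + f) pc m = exec P f pc' m'.

Lemma steps0 P pc m : steps P 0 pc m pc m.
Proof. by []. Qed.

Lemma steps_trans P d1 d2 pc m pc1 m1 pc2 m2 :
  steps P d1 pc m pc1 m1 -> steps P d2 pc1 m1 pc2 m2 ->
  steps P (d1 + d2) pc m pc2 m2.
Proof. by move=> H1 H2 f; rewrite -addnA H1 H2. Qed.

Lemma steps_cons P d pc m pc1 m1 pc2 m2 :
  step P pc m = Some (pc1, m1) -> steps P d pc1 m1 pc2 m2 ->
  steps P d.+1 pc m pc2 m2.
Proof. by move=> H1 H2 f; rewrite addSn /= H1 H2. Qed.

Lemma steps_cons1 P pc m pc1 m1 :
  step P pc m = Some (pc1, m1) -> steps P 1 pc m pc1 m1.
Proof. by move=> H; apply: steps_cons H (steps0 _ _ _). Qed.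

Definition istep (m : memory) (i : instr) : memory :=
  match i with
  | IConst i c => upd m i c
  | IAdd i j l => upd m i (m j + m l)
  | ISub i j l => upd m i (m j - m l)
  | ILoad i j => upd m i (m (m j))
  | IStore i j => upd m (m i) (m j)
  | _ => m
  end.

Definition straight (i : instr) : bool :=
  match i with IJz _ _ | IJmp _ | IHalt => false | _ => true end.

Lemma steps_straight P pc l m : code_at P pc l -> all straight l ->
  steps P (size l) pc m (pc + size l) (foldl istep m l).
Proof.
elim: l pc m => [|i l IH] pc m; first by rewrite addn0.
move=> /code_at_cons[Hi Hl] /andP[si sl] /=; rewrite addnS -addSn.
apply: steps_cons (IH _ _ Hl sl); rewrite /step Hi.
by case: i si {Hi}.
Qed.

(** * Simulation of structured programs by compiled code *)

Section Simulation.

Variables (I S : Type) (sem : S -> I -> S) (get : S -> nat -> nat).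
Variables (cb : I -> program) (rep : S -> memory -> Prop).
Variables (okb : I -> bool) (okr : nat -> bool) (K : nat).
Hypothesis K_ge2 : 1 < K.
Hypothesis cb_straight : forall b, okb b -> all straight (cb b).
Hypothesis cb_size : forall b, okb b -> size (cb b) <= K.
Hypothesis cb_sim : forall b s m, okb b -> rep s m -> rep (sem s b) (foldl istep m (cb b)).
Hypothesis get_sim : forall r s m, okr r -> rep s m -> m r = get s r.

(** Every credit pays for at most [K] machine steps: a block has at most [K] instructions, and a
    test together with the jump closing its branch or loop body takes two steps, whence [K_ge2]. In
    additive form the bound telescopes along sequences. *)
Lemma compile_sim c s t s' t' : ev sem get c s t s' t' ->
  forall P pc m, all_cmd okb okr c -> code_at P pc (compile cb pc c) -> rep s m ->
  exists m' d, [/\ rep s' m', d + K * t' <= K * t &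
    steps P d pc m (pc + size (compile cb pc c)) m'].
Proof.
elim=> {c s t s' t'}.
- move=> b s t P pc m /= okc code r.
  exists (foldl istep m (cb b)), (size (cb b)); split; first exact: cb_sim.
    by have := cb_size okc; lia.
  exact: steps_straight (cb_straight okc).
- move=> c1 c2 s t s1 t1 s2 t2 _ IH1 _ IH2 P pc m /= /andP[ok1 ok2].
  move=> /code_at_cat[code1 code2] r.
  have [m1 [d1 [r1 le1 st1]]] := IH1 _ _ _ ok1 code1 r.
  have [m2 [d2 [r2 le2 st2]]] := IH2 _ _ _ ok2 code2 r1.
  exists m2, (d1 + d2); split=> //; first by lia.
  by rewrite size_cat addnA; apply: steps_trans st1 st2.
- move=> r c1 c2 s t s' t' rN0 _ IH P pc m /= /and3P[okr_ ok1 ok2].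
  move=> /code_at_cons[jz] /code_at_cat[code1] /code_at_cons[jmp code2] rp.
  have [m1 [d1 [r1 le1 st1]]] := IH _ _ _ ok1 code1 rp.
  exists m1, (d1 + 1).+1; split=> //; first by rewrite mulnS; lia.
  apply: (@steps_cons _ _ _ _ pc.+1 m).
    by rewrite /step jz (get_sim okr_ rp) (negPf rN0).
  apply: steps_trans st1 _; apply: steps_cons1.
  by rewrite /step jmp /= size_cat /=; congr (Some (_, _)); lia.
- move=> r c1 c2 s t s' t' r0 _ IH P pc m /= /and3P[okr_ ok1 ok2].
  move=> /code_at_cons[jz] /code_at_cat[code1] /code_at_cons[jmp code2] rp.
  have E : (pc.+1 + size (compile cb pc.+1 c1)).+1 = (pc + size (compile cb pc.+1 c1)).+2 by lia.
  rewrite E in code2.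
  have [m1 [d1 [r1 le1 st1]]] := IH _ _ _ ok2 code2 rp.
  exists m1, d1.+1; split=> //; first by rewrite mulnS; lia.
  apply: (@steps_cons _ _ _ _ (pc + size (compile cb pc.+1 c1)).+2 m).
    by rewrite /step jz (get_sim okr_ rp) r0.
  suff <- : (pc + size (compile cb pc.+1 c1)).+2 +
            size (compile cb (pc + size (compile cb pc.+1 c1)).+2 c2) =
         pc + (size (compile cb pc.+1 c1 ++
           IJmp (pc + size (compile cb pc.+1 c1) +
             size (compile cb (pc + size (compile cb pc.+1 c1)).+2 c2)).+2 ::
             compile cb (pc + size (compile cb pc.+1 c1)).+2 c2)).+1 by [].
  by rewrite size_cat /=; lia.
- move=> r c s t r0 P pc m /= /andP[okr_ okc] /code_at_cons[jz _] rp.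
  exists m, 1; split=> //; first by rewrite mulnS; lia.
  apply: steps_cons1.
  by rewrite /step jz (get_sim okr_ rp) r0 size_rcons /=; congr (Some (_, _)); lia.
- move=> r c s t s1 t1 s2 t2 rN0 _ IH1 _ IH2 P pc m okc code rp.
  have := code; move=> /= /code_at_cons[jz]; rewrite -cats1 => /code_at_cat[code1].
  move=> /code_at_cons[jmp _]; rewrite cats1; have := okc; move=> /= /andP[okr_ ok1].
  have [m1 [d1 [r1 le1 st1]]] := IH1 _ _ _ ok1 code1 rp.
  have [m2 [d2 [r2 le2 st2]]] := IH2 _ _ _ okc code r1.
  exists m2, (d1 + d2.+1).+1; split=> //; first by rewrite mulnS; lia.
  apply: (@steps_cons _ _ _ _ pc.+1 m).
    by rewrite /step jz (get_sim okr_ rp) (negPf rN0).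
  apply: steps_trans st1 _; apply: steps_cons st2.
  by rewrite /step jmp.
Qed.

End Simulation.

(** * The zero-one law in terms of reachability *)

Section ZeroOne.

Variables (k : nat) (D : dfa k).
Hypothesis k_gt0 : 0 < k.
Implicit Types (X Y : pred 'I_(nst D)) (q : 'I_(nst D)).

Local Notation "q · w" := (foldl (@delta k D) q w) (at level 40, left associativity).

Fixpoint cnt X (m : nat) q : nat :=
  if m is m'.+1 then \sum_(a < k) cnt X m' (delta q a) else X q.

Lemma cnt_tuple X m q : #|[set w : m.-tuple 'I_k | X (q · w)]| = cnt X m q.
Proof.
elim: m q => [|m IH] q /=.
  have -> : [set w : 0.-tuple 'I_k | X (q · w)] = if X q then setT else set0.
    by apply/setP => w; rewrite tuple0 inE /=; case: (X q); rewrite inE.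
  by case: (X q); rewrite ?cardsT ?card_tuple ?cards0.
under eq_bigr do rewrite -IH.
rewrite -sum1_card.
(* A nonempty word is the pair of its first letter and the remaining word. *)
have -> : \sum_(w in [set w : m.+1.-tuple 'I_k | X (q · w)]) 1 =
   \sum_(a < k) \sum_(w : m.-tuple 'I_k | X (delta q a · w)) 1.
  rewrite pair_big_dep /=.
  rewrite (reindex (fun p : 'I_k * m.-tuple 'I_k => [tuple of p.1 :: p.2])) /=.
    by apply: eq_bigl => -[a w]; rewrite inE.
  exists (fun w : m.+1.-tuple 'I_k => (thead w, [tuple of behead w])) => /=.
    by move=> [a w] _ /=; congr pair; apply: val_inj.
  by move=> w _; rewrite [RHS](tuple_eta w).
by apply: eq_bigr => a _; rewrite -sum1_card; apply: eq_bigl => w; rewrite inE.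
Qed.

Lemma cnt_count m : count_len D m = cnt (@dfinal k D) m (dinit D).
Proof. by rewrite -cnt_tuple. Qed.

Lemma sum_ord_const (c : nat) : \sum_(a < k) c = k * c.
Proof. by rewrite sum_nat_const card_ord. Qed.

Lemma cnt_predC X m q : cnt X m q + cnt (predC X) m q = k ^ m.
Proof.
elim: m q => [|m IH] q /=; first by case: (X q).
by rewrite -big_split /= (eq_bigr (fun=> k ^ m)) // sum_ord_const expnS.
Qed.

Lemma cnt_le X m q : cnt X m q <= k ^ m.
Proof. by rewrite -(cnt_predC X m q) leq_addr. Qed.

Lemma cnt_sub X Y m q : subpred X Y -> cnt X m q <= cnt Y m q.
Proof.
move=> XY; elim: m q => [|m IH] q /=; last by apply: leq_sum => a _.
by have := XY q; case: (X q) => // ->.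
Qed.

Lemma cnt_gt0 X w q : X (q · w) -> 0 < cnt X (size w) q.
Proof.
elim: w q => [|a w IH] q /=; first by move->.
by move/IH => H; rewrite (bigD1 a) //=; lia.
Qed.

Definition closed_pred Y := forall q a, Y q -> Y (delta q a).

Lemma cnt_closed0 Y m q : closed_pred Y -> Y q -> cnt (predC Y) m q = 0.
Proof.
move=> cY; elim: m q => [|m IH] q Yq /=; first by rewrite Yq.
by rewrite big1 // => a _; apply: IH; apply: cY.
Qed.

Lemma closed_word Y w q : closed_pred Y -> Y q -> Y (q · w).
Proof. by move=> cY; elim: w q => //= a w IH q Yq; apply/IH/cY. Qed.

(** Integer form of [cnt X m q / k ^ m] tending to zero, with [E] for the inverse of epsilon. *)
Definition vanish X q := forall E, exists M, forall m, M <= m -> E * cnt X m q <= k ^ m.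

(** Bernoulli's inequality [(1 + 1/p)^j >= 1 + j/p] with denominators cleared. *)
Lemma bernoulli p j : (p + j) * p ^ j <= p * p.+1 ^ j.
Proof.
elim: j => [|j IH]; first by rewrite addn0 !expn0.
rewrite !expnS; nia.
Qed.

(* Outside a closed set that every state can reach within [L] steps, the mass
   shrinks by the factor [1 - k^-L] every [L] steps. *)
Lemma vanish_closed Y q : closed_pred Y -> (forall q, exists w, Y (q · w)) ->
  vanish (predC Y) q.
Proof.
move=> cY reach.
(* Words into [Y] get the common length [L] by padding with an arbitrary letter, which does not
   leave the closed set [Y]. *)
have [L HL] : exists L, forall q, exists2 w, size w = L & Y (q · w).
  have [f Hf] := fin_all_exists reach.
  exists (\max_q size (f q)) => q'.
  exists (f q' ++ nseq (\max_q size (f q) - size (f q')) (Ordinal k_gt0)).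
    by rewrite size_cat size_nseq subnKC // (leq_bigmax (F := fun q => size (f q))).
  by rewrite foldl_cat; apply: closed_word.
(* From any state at least one of the [k ^ L] words of length [L] leads into [Y]; from a state of
   [Y] no word leads out. *)
have decay m r : cnt (predC Y) (m + L) r <= (k ^ L).-1 * cnt (predC Y) m r.
  elim: m r => [|m IH] r; last by rewrite addSn /= big_distrr; apply: leq_sum.
  rewrite add0n /=; case Yr: (Y r); first by rewrite cnt_closed0.
  rewrite muln1; have [w <- Yw] := HL r.
  have := @cnt_gt0 Y w r Yw; have := cnt_predC Y (size w) r; lia.
have decayj j m r : cnt (predC Y) (m + j * L) r <= (k ^ L).-1 ^ j * cnt (predC Y) m r.
  elim: j => [|j IH]; first by rewrite addn0 mul1n.
  rewrite mulSn addnCA addnC expnS -mulnA (leq_trans (decay _ _)) //.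
  by rewrite leq_mul2l IH orbT.
move=> E; set p := (k ^ L).-1.
have pK : k ^ L = p.+1 by rewrite prednK // expn_gt0 k_gt0.
(* For [j = E * p] Bernoulli yields [(E + 1) * p ^ j <= (p + 1) ^ j] after cancelling [p]; hence the
   separate case [p = 0]. *)
have [j Hj] : exists j, E * p ^ j <= p.+1 ^ j.
  have [p0|pp] := posnP p; first by exists 1; rewrite p0 muln0.
  exists (E * p); have := bernoulli p (E * p).
  have -> : p + E * p = p * E.+1 by rewrite mulnS [E * p]mulnC.
  rewrite -mulnA leq_pmul2l // => H; apply: leq_trans H.
  by rewrite leq_mul2r leqnSn orbT.
exists (j * L) => m lem; rewrite -(subnK lem).
apply: (@leq_trans (E * (p ^ j * cnt (predC Y) (m - j * L) q))).
  by rewrite leq_mul2l decayj orbT.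
rewrite mulnA expnD mulnC [j * L]mulnC expnM pK.
by apply: leq_mul => //; apply: cnt_le.
Qed.

(* If [X] can be reached within [N] steps from all states reachable from [r], then
   [X] has mass at least [k^-N] at one of any [N + 1] consecutive times. *)
Lemma vanish_avoid X q u : vanish X q -> exists w, forall w', ~~ X (q · u · w · w').
Proof.
move=> van; apply: NNPP => nogood.
have back w : exists w', X (q · u · w · w').
  apply: NNPP => H; apply: nogood; exists w => w'; apply/negP => Xw'.
  by apply: H; exists w'.
(* [f r] bounds the length of some word from [r] into [X], with value 0 where there is none; its
   maximum is [N]. *)
have [f Hf] : exists f : 'I_(nst D) -> nat,
    forall r, (exists w, X (r · w)) -> exists2 w, size w <= f r & X (r · w).
  apply: (fin_all_exists (P := fun r n => (exists w, X (r · w)) ->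
    exists2 w, size w <= n & X (r · w))) => r.
  have [[w Xw]|nX] := classic (exists w, X (r · w)); first by exists (size w); exists w.
  by exists 0 => /nX.
set N := \max_r f r.
have low m r : (forall w, exists w', X (r · w · w')) ->
    k ^ m <= \sum_(i < N.+1) cnt X (m + i) r.
  elim: m r => [|m IH] r Hr.
    have [w lew Xw] := Hf r (Hr [::]).
    have ltN : size w < N.+1 by rewrite ltnS (leq_trans lew) // leq_bigmax.
    by rewrite (bigD1 (Ordinal ltN)) //= add0n expn0; have := cnt_gt0 Xw; lia.
  rewrite (eq_bigr (fun i : 'I_N.+1 => \sum_(a < k) cnt X (m + i) (delta r a))) //.
  rewrite exchange_big /= expnS -sum_ord_const; apply: leq_sum => a _.
  by apply: IH => w; have := Hr (a :: w).
have pre m v r : cnt X m (r · v) <= cnt X (size v + m) r.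
  elim: v r => [|a v IH] r //=; rewrite (bigD1 a) //=.
  by rewrite (leq_trans (IH _)) // leq_addr.
(* This constant exceeds [(N + 1) * k ^ (size u + N)]: summing the vanishing bound over the times
   [size u + M + i] with [i <= N] then contradicts [low]. *)
have [M HM] := van (N.+1 * k ^ (size u + N)).+1.
have := low M (q · u) back; apply/negP; rewrite -ltnNge.
have kM : 0 < k ^ M by rewrite expn_gt0 k_gt0.
set E := (_ * _).+1 in HM.
rewrite -(ltn_pmul2l (isT : 0 < E)) big_distrr /=.
apply: (@leq_ltn_trans (\sum_(i < N.+1) k ^ (size u + N + M))).
  apply: leq_sum => i _.
  apply: (@leq_trans (E * cnt X (size u + (M + i)) q)); first by rewrite leq_mul2l pre orbT.
  apply: leq_trans (HM _ _) _; first by lia.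
  by rewrite leq_pexp2l //; have := ltn_ord i; lia.
by rewrite sum_nat_const card_ord (expnD k (size u + N)) mulnA /E mulSn -subn_gt0 addnK.
Qed.

(** For the converse, the states from which [X] is unreachable form a closed set [Y] that every
    state can reach, and [X] lies in its complement. *)
Lemma vanishP X q : (forall r, exists w, q · w = r) ->
  vanish X q <-> forall r, exists w, forall w', ~~ X (r · w · w').
Proof.
move=> acc; split=> [van r|H].
  by have [u <-] := acc r; apply: vanish_avoid.
have [Y HY] : exists Y : 'I_(nst D) -> bool, forall r, Y r <-> forall w, ~~ X (r · w).
  apply: (fin_all_exists (P := fun r (y : bool) => y <-> forall w, ~~ X (r · w))) => r.
  by have [h|h] := classic (forall w, ~~ X (r · w)); [exists true | exists false].
have cY : closed_pred Y.
  by move=> r a /HY h; apply/HY => w; apply: (h (a :: w)).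
have van : vanish (predC Y) q.
  by apply: vanish_closed => // r; have [w Hw] := H r; exists w; apply/HY.
move=> E; have [M HM] := van E; exists M => m leM; apply: leq_trans (HM m leM).
rewrite leq_mul2l; apply/orP; right; apply: cnt_sub => r Xr /=; apply/negP => /HY.
by move=> /(_ [::]); rewrite /= Xr.
Qed.

Local Open Scope R_scope.

Lemma INR_expn m : INR (k ^ m)%N = pow (INR k) m.
Proof. by elim: m => [|m IH] //=; rewrite expnS mult_INR IH. Qed.

Lemma pow_k_gt0 m : 0 < pow (INR k) m.
Proof. by apply: pow_lt; apply: lt_0_INR; apply/ltP. Qed.

Lemma vanish_cv X q :
  vanish X q <-> Un_cv (fun m => INR (cnt X m q) / pow (INR k) m) 0.
Proof.
split=> [van eps eps0|cv E].
  have [E HE] := INR_unbounded (/ eps).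
  have [M HM] := van E; exists M => m /leP leM.
  have kp := pow_k_gt0 m.
  have := HM m leM => /leP /le_INR; rewrite mult_INR INR_expn => HmR.
  have cp : 0 <= INR (cnt X m q) by apply: pos_INR.
  have epsi := Rinv_0_lt_compat _ eps0.
  rewrite /R_dist Rminus_0_r Rabs_pos_eq; last first.
    by apply: Rmult_le_pos => //; apply/Rlt_le/Rinv_0_lt_compat.
  apply: (Rmult_lt_reg_r (pow (INR k) m)) => //.
  rewrite /Rdiv Rmult_assoc Rinv_l ?Rmult_1_r; last by lra.
  apply: (Rmult_lt_reg_l (/ eps)) => //.
  rewrite -Rmult_assoc Rinv_l ?Rmult_1_l; last by lra.
  (* Multiplying by a zero count would destroy the strict inequality. *)
  have [c0|c0] := Req_dec (INR (cnt X m q)) 0; first by rewrite c0 Rmult_0_r.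
  by apply: Rlt_le_trans HmR; apply: Rmult_lt_compat_r => //; lra.
have Ep : 0 < INR E.+1 by apply: lt_0_INR; apply/ltP.
have [M HM] := cv _ (Rinv_0_lt_compat _ Ep).
exists M => m /leP leM; have kp := pow_k_gt0 m.
have := HM m leM; rewrite /R_dist Rminus_0_r => /(Rle_lt_trans _ _ _ (Rle_abs _)) lt.
apply/leP/INR_le; rewrite mult_INR INR_expn.
have cp : 0 <= INR (cnt X m q) by apply: pos_INR.
have : INR (cnt X m q) < / INR E.+1 * pow (INR k) m.
  apply: (Rmult_lt_reg_r (/ pow (INR k) m)); first exact: Rinv_0_lt_compat.
  by rewrite Rmult_assoc Rinv_r ?Rmult_1_r //; lra.
move=> /(Rmult_lt_compat_l _ _ _ Ep); rewrite -Rmult_assoc Rinv_r ?Rmult_1_l; last by lra.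
by rewrite S_INR; nra.
Qed.

(** Limit 0 means that the final states vanish, limit 1 that the non-final ones do; [vanishP]
    applies to both. *)
Lemma zero_oneP : accessible D -> 
  zero_one_law D <-> exists b : bool, forall q, exists w, forall w', dfinal (q · w · w') = b.
Proof.
move=> acc.
have compl m : INR (count_len D m) / pow (INR k) m =
    1 - INR (cnt (predC (@dfinal k D)) m (dinit D)) / pow (INR k) m.
  have kp := pow_k_gt0 m.
  have := cnt_predC (@dfinal k D) m (dinit D); rewrite -cnt_count => /(congr1 INR).
  by rewrite plus_INR INR_expn => H; field_simplify_eq; lra.
have v0 := vanishP (@dfinal k D) acc; have v1 := vanishP (predC (@dfinal k D)) acc.
have c0 := vanish_cv (@dfinal k D) (dinit D).
have c1 := vanish_cv (predC (@dfinal k D)) (dinit D).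
split=> [[l [[->|->] cv]]|[[] H]].
- have /v0 H : vanish (@dfinal k D) (dinit D).
    by apply/c0 => eps /cv[M HM]; exists M => m /HM; rewrite cnt_count.
  by exists false => q; have [w Hw] := H q; exists w => w'; apply/negbTE.
- have /v1 H : vanish (predC (@dfinal k D)) (dinit D).
    apply/c1 => eps /cv[M HM]; exists M => m /HM; rewrite /R_dist compl.
    by rewrite -Rabs_Ropp; congr (Rabs _ < _); lra.
  by exists true => q; have [w Hw] := H q; exists w => w'; apply/negbNE/Hw.
- exists 1; split; first by right.
  have /c1 cv : vanish (predC (@dfinal k D)) (dinit D).
    by apply/v1 => q; have [w Hw] := H q; exists w => w'; rewrite /= Hw.
  move=> eps /cv[M HM]; exists M => m /HM; rewrite /R_dist compl.
  by rewrite -Rabs_Ropp; congr (Rabs _ < _); lra.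
- exists 0; split; first by left.
  have /c0 cv : vanish (@dfinal k D) (dinit D).
    by apply/v0 => q; have [w Hw] := H q; exists w => w'; rewrite Hw.
  by move=> eps /cv[M HM]; exists M => m /HM; rewrite cnt_count.
Qed.

End ZeroOne.

(** * The linear-time algorithm on registers and arrays *)

Inductive hinstr :=
  | HConst (r c : nat)
  | HAdd (r a b : nat)
  | HSub (r a b : nat)
  | HLoad (r A i : nat)
  | HStore (A i r : nat).

Record hstate := HState { reg : nat -> nat; arr : nat -> nat -> nat }.

(* [Nat.eqb] computes under [simpl], unlike [==]. *)
Definition set_reg (s : hstate) (r v : nat) : hstate :=
  HState (fun x => if Nat.eqb x r then v else reg s x) (arr s).

Definition set_arr (s : hstate) (A i v : nat) : hstate :=
  HState (reg s)
    (fun A' j => if Nat.eqb A' A then if j == i then v else arr s A' j else arr s A' j).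

Definition hsem1 (s : hstate) (i : hinstr) : hstate :=
  match i with
  | HConst r c => set_reg s r c
  | HAdd r a b => set_reg s r (reg s a + reg s b)
  | HSub r a b => set_reg s r (reg s a - reg s b)
  | HLoad r A i => set_reg s r (arr s A (reg s i))
  | HStore A i r => set_arr s A (reg s i) (reg s r)
  end.

Local Notation hsem := (foldl hsem1).
Definition hcmd := cmd (seq hinstr).
Definition hwp : hcmd -> (hstate -> nat -> Prop) -> hstate -> nat -> Prop := wp hsem reg.

(** Register numbers are memory addresses. [rN] is cell 0, where the input has [n] and the answer is
    expected; cells 13 and 14 are kept for address computations. *)
Local Notation rN := 0 (only parsing).
Local Notation rOne := 1 (only parsing).
Local Notation rQ := 2 (only parsing).
Local Notation rA := 3 (only parsing).
Local Notation rE := 4 (only parsing).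
Local Notation rV := 5 (only parsing).
Local Notation rP := 6 (only parsing).
Local Notation rSp := 7 (only parsing).
Local Notation rU := 8 (only parsing).
Local Notation rT := 9 (only parsing).
Local Notation rK := 10 (only parsing).
Local Notation rZero := 11 (only parsing).
Local Notation rRes := 12 (only parsing).
Local Notation aIn := 0 (only parsing).
Local Notation aHead := 1 (only parsing).
Local Notation aNext := 2 (only parsing).
Local Notation aSrc := 3 (only parsing).
Local Notation aMark := 4 (only parsing).
Local Notation aStk := 5 (only parsing).

(** Edge [q * k + a] is pushed onto the list of its target. Counting [q] and [a] along with [rE]
    gives the source without division; [rN + rE] skips the [n] final bits of the input. *)
Definition build (k : nat) : hcmd :=
  Seq (Bas [:: HConst rOne 1; HConst rZero 0; HConst rK k; HConst rQ 0; HConst rA 0;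
               HConst rE 0; HSub rT rN rQ])
  (While rT
    (Seq (Bas [:: HAdd rT rN rE; HLoad rV aIn rT; HLoad rU aHead rV; HAdd rE rE rOne;
                  HStore aNext rE rU; HStore aHead rV rE; HStore aSrc rE rQ;
                  HAdd rA rA rOne; HSub rT rK rA])
    (Seq (If rT (Bas [::]) (Bas [:: HConst rA 0; HAdd rQ rQ rOne]))
         (Bas [:: HSub rT rN rQ])))).

Definition load_marks (b : bool) : hcmd :=
  Seq (Bas [:: HConst rV 0; HSub rT rN rV])
  (While rT
    (Bas ([:: HLoad rU aIn rV] ++ (if b then [::] else [:: HSub rU rOne rU]) ++
          [:: HStore aMark rV rU; HAdd rV rV rOne; HSub rT rN rV]))).

Definition flip : hcmd :=
  Seq (Bas [:: HConst rV 0; HConst rSp 0; HSub rT rN rV])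
  (While rT
    (Seq (Bas [:: HLoad rU aMark rV])
    (Seq (If rU (Bas [:: HStore aMark rV rZero])
                (Bas [:: HStore aMark rV rOne; HStore aStk rSp rV; HAdd rSp rSp rOne]))
         (Bas [:: HAdd rV rV rOne; HSub rT rN rV])))).

(** Each round handles an edge of the current list [rP] or, if that is empty, pops a state; [rT] is
    zero only when list and stack are both exhausted. With a single loop, one potential bounds the
    running time. *)
Definition search : hcmd :=
  Seq (Bas [:: HConst rP 0; HAdd rT rP rSp])
  (While rT
    (Seq (If rP
      (Seq (Bas [:: HLoad rU aSrc rP; HLoad rP aNext rP; HLoad rT aMark rU])
           (If rT (Bas [::])
             (Bas [:: HStore aMark rU rOne; HStore aStk rSp rU; HAdd rSp rSp rOne])))
      (Bas [:: HSub rSp rSp rOne; HLoad rV aStk rSp; HLoad rP aHead rV]))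
    (Bas [:: HAdd rT rP rSp]))).

Definition all_marked : hcmd :=
  Seq (Bas [:: HConst rA 1; HConst rV 0; HSub rT rN rV])
  (While rT
    (Seq (Bas [:: HLoad rU aMark rV])
    (Seq (If rU (Bas [::]) (Bas [:: HConst rA 0]))
         (Bas [:: HAdd rV rV rOne; HSub rT rN rV])))).

(** [load_marks b] marks the complement of the first seeds, since [flip] inverts the marks and
    stacks the newly marked states. The first search finds the states that are not [b]-good, the
    second those that reach a [b]-good one. *)
Definition test (b : bool) : hcmd :=
  Seq (load_marks b) (Seq flip (Seq search (Seq flip (Seq search all_marked)))).

(** The last block computes the disjunction of two bits [x] and [y] by truncated subtraction, as
    [1 - ((1 - x) - y)]. *)
Definition main (k : nat) : hcmd :=
  Seq (build k) (Seq (test true) (Seq (Bas [:: HAdd rRes rA rZero]) (Seq (test false)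
    (Bas [:: HSub rN rOne rRes; HSub rN rN rA; HSub rN rOne rN])))).

(** * Correctness and running time of the algorithm *)

Section Algorithm.

Variables (n k : nat) (fin : nat -> bool) (tgt : nat -> nat).
Hypothesis k_gt0 : 0 < k.
Hypothesis tgt_lt : forall e, e < n * k -> tgt e < n.

(* A pointer [e.+1] denotes the edge [e], and [0] the empty list. *)
Fixpoint last_edge (v b : nat) : nat :=
  if b is e.+1 then if tgt e == v then b else last_edge v e else 0.

Fixpoint indeg (v b : nat) : nat :=
  if b is e.+1 then (tgt e == v) + indeg v e else 0.

Lemma last_edge_le v b : last_edge v b <= b.
Proof. by elim: b => //= b IH; case: ifP => // _; apply: leq_trans IH _. Qed.

Lemma tgt_last_edge v b p : last_edge v b = p.+1 -> tgt p = v.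
Proof. by elim: b => //= b IH; case: ifP => // /eqP E [<-]. Qed.

(** Moving down to a list pointer skips no edge into [v], so the potential of the search can be read
    off the pointers. *)
Lemma indeg_last_edge v b : indeg v (last_edge v b) = indeg v b.
Proof. by elim: b => //= b IH; case: ifP => E //=; rewrite E. Qed.

Lemma last_edge_max v b e : e < b -> tgt e = v -> e < last_edge v b.
Proof.
elim: b => //= b IH; rewrite ltnS leq_eqVlt => /orP[/eqP-> -> |lt E].
  by rewrite eqxx.
by case: ifP => // _; [lia | apply: IH].
Qed.

(** Lists are in decreasing order: [last_edge (tgt e) e] points to the closest earlier edge with the
    target of [e]. *)
Record graph_ok (s : hstate) : Prop := GraphOk {
  g_n : reg s rN = n;
  g_one : reg s rOne = 1;
  g_zero : reg s rZero = 0;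
  g_fin : forall v, v < n -> arr s aIn v = fin v;
  g_head : forall v, v < n -> arr s aHead v = last_edge v (n * k);
  g_next : forall e, e < n * k -> arr s aNext e.+1 = last_edge (tgt e) e;
  g_src : forall e, e < n * k -> arr s aSrc e.+1 = e %/ k }.

Lemma build_ok (Q : hstate -> nat -> Prop) s t :
  reg s rN = n -> (forall v, v < n -> arr s aIn v = fin v) ->
  (forall e, e < n * k -> arr s aIn (n + e) = tgt e) ->
  (forall v, arr s aHead v = 0) ->
  5 * (n * k) + 2 <= t ->
  (forall s' t', graph_ok s' -> t <= t' + (5 * (n * k) + 2) -> Q s' t') ->
  hwp (build k) Q s t.
Proof.
move=> sn sfin stgt shead let_t HQ.
apply/wp_seq/wp_bas; first by lia.
rewrite /=.
(* The two credit inequalities bound what is spent and secure what is still needed: five credits for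
   each edge, one for the initial block and one for the final test. *)
pose J (s' : hstate) t' := exists q a, [/\ a < k, q * k + a <= n * k, 
   reg s' rQ = q, reg s' rA = a & reg s' rE = q * k + a] /\
   [/\ reg s' rN = n, reg s' rOne = 1, reg s' rZero = 0, reg s' rK = k & reg s' rT = n - q] /\
   [/\ arr s' aIn = arr s aIn, 
   forall v, v < n -> arr s' aHead v = last_edge v (q * k + a),
   forall e, e < q * k + a -> arr s' aNext e.+1 = last_edge (tgt e) e,
   forall e, e < q * k + a -> arr s' aSrc e.+1 = e %/ k &
   t <= t' + 5 * (q * k + a) + 1 /\ 5 * (n * k - (q * k + a)) < t'].
apply: (wp_while (Inv := J)).
- by move=> s1 t1 [q [a [_ [_ [_ _ _ _ [_]]]]]]; lia.
- move=> s1 t1 [q [a [[a1 a2 a3 a4 a5] [[b1 b2 b3 b4 b5] [c1 c2 c3 c4 [c5 c6]]]]]] r0.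
  have qn : q = n by nia.
  have a0 : a = 0 by nia.
  move: c2 c3 c4 c5 c6; rewrite qn a0 addn0 => c2 c3 c4 c5 c6.
  apply: HQ; last by lia.
  by split=> //; rewrite c1.
- move=> s1 t1 [q [a [[a1 a2 a3 a4 a5] [[b1 b2 b3 b4 b5] [c1 c2 c3 c4 [c5 c6]]]]]] rN0.
  have lt_e : q * k + a < n * k by nia.
  have tn := tgt_lt lt_e.
  apply/wp_seq/wp_bas; first by lia.
  rewrite /= b1 b2 a5 a3 a4 b4 c1 stgt // addn1.
  set s2 := (X in wp _ _ _ _ X _).
  have H2 : [/\ forall v, v < n -> arr s2 aHead v = last_edge v (q * k + a).+1,
      forall e, e < (q * k + a).+1 -> arr s2 aNext e.+1 = last_edge (tgt e) e &
      forall e, e < (q * k + a).+1 -> arr s2 aSrc e.+1 = e %/ k].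
    split=> [v lv|e le|e le]; rewrite /s2 /=.
    - by rewrite eq_sym; case: eqP => // _; rewrite c2.
    - rewrite eqSS; case: eqP => [->|ne]; first by rewrite c2.
      by rewrite c3 //; lia.
    - rewrite eqSS; case: eqP => [->|ne]; first by rewrite divnMDl // divn_small ?addn0.
      by rewrite c4 //; lia.
  move: H2 => [d2 d3 d4].
  apply/wp_seq/wp_if; first by lia.
    rewrite /= => ka; apply: wp_bas; first by lia.
    apply: wp_bas => /=; first by lia.
    exists q, a.+1; rewrite /= addnS !addn1 b1 a3; split; first by split=> //; lia.
    by split=> //; split=> //; split; lia.
  rewrite /= => ka; apply: wp_bas; first by lia.
  apply: wp_bas => /=; first by lia.
  have ak : q.+1 * k + 0 = (q * k + a).+1 by nia.
  exists q.+1, 0; rewrite /= !addn1 ak b1 a3 b2 addn1; split; first by split=> //; nia.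
  by split=> //; split=> //; split; lia.
- exists 0, 0; rewrite /= sn mul0n addn0; split; first by split.
  split=> //; split=> //; lia.
Qed.

Definition same_graph (s s' : hstate) : Prop :=
  [/\ reg s' rN = reg s rN, reg s' rOne = reg s rOne, reg s' rZero = reg s rZero &
      reg s' rRes = reg s rRes] /\
  [/\ arr s' aIn = arr s aIn, arr s' aHead = arr s aHead,
      arr s' aNext = arr s aNext & arr s' aSrc = arr s aSrc].

Lemma same_graph_ok s s' : same_graph s s' -> graph_ok s -> graph_ok s'.
Proof.
move=> [[e1 e2 e3 _] [f1 f2 f3 f4]] [g1 g2 g3 g4 g5 g6 g7].
by split; rewrite ?e1 ?e2 ?e3 ?f1 ?f2 ?f3 ?f4.
Qed.

Definition marks (s : hstate) (M : nat -> bool) : Prop :=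
  forall v, v < n -> arr s aMark v = M v.

Lemma load_marks_ok b (Q : hstate -> nat -> Prop) s t :
  graph_ok s -> 2 * n + 2 <= t ->
  (forall s' t', graph_ok s' -> reg s' rRes = reg s rRes ->
     marks s' (fun v => fin v == b) -> t <= t' + (2 * n + 2) -> Q s' t') ->
  hwp (load_marks b) Q s t.
Proof.
move=> G let_t HQ; apply/wp_seq/wp_bas; first by lia.
pose J (s' : hstate) t' := exists v, [/\ v <= n, reg s' rV = v & reg s' rT = n - v] /\
   [/\ graph_ok s', reg s' rRes = reg s rRes,
   forall u, u < v -> arr s' aMark u = (fin u == b) &
   t <= t' + 2 * v + 1 /\ 2 * (n - v) < t'].
apply: (wp_while (Inv := J)).
- by move=> s1 t1 [v [_ [_ _ _]]]; lia.
- move=> s1 t1 [v [[a1 a2 a3] [G1 b1 b2 b3]]] r0.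
  have vn : v = n by lia.
  by rewrite vn in b2 b3; apply: HQ => //; lia.
- move=> s1 t1 [v [[a1 a2 a3] [G1 b1 b2 b3]]] rN0.
  have vn : v < n by lia.
  apply: wp_bas; first by lia.
  exists v.+1; case: b b2 {HQ J} => b2 /=.
    rewrite a2 (g_n G1) (g_one G1) (g_fin G1) // addn1; split; first by split.
    split=> //; last by lia.
      by apply: same_graph_ok G1.
    move=> u; rewrite ltnS leq_eqVlt; case: eqP => [-> _|ne lt] /=.
      by case: (fin v).
    exact: b2.
  rewrite a2 (g_n G1) (g_one G1) (g_fin G1) // addn1; split; first by split.
  split=> //; last by lia.
    by apply: same_graph_ok G1.
  move=> u; rewrite ltnS leq_eqVlt; case: eqP => [-> _|ne lt] /=.
    by case: (fin v).
  exact: b2.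
- exists 0 => /=; rewrite (g_n G); split; first by split.
  by split=> //; [apply: same_graph_ok G | lia].
Qed.

(** Rounds of the search loop that a state costs: one to pop it and one for each incoming edge. *)
Definition weight (v : nat) : nat := (indeg v (n * k)).+1.

Definition unmarked_weight (M : nat -> bool) (m : nat) : nat :=
  \sum_(u < m) if M u then 0 else weight u.

Definition stack_weight (s : hstate) (sp : nat) : nat :=
  \sum_(i < sp) weight (arr s aStk i).

(** Every edge counts at exactly one target. *)
Lemma sum_weight : \sum_(v < n) weight v = n + n * k.
Proof.
have H b : b <= n * k -> \sum_(v < n) indeg v b = b.
  elim: b => [|b IH] leb /=; first by rewrite big1.
  rewrite big_split /= IH; last by lia.
  rewrite (bigD1 (Ordinal (tgt_lt leb))) //= eqxx big1 ?addn0 //.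
  by move=> i; rewrite eq_sym -val_eqE /= => /negPf->.
rewrite /weight -[RHS]addn0 (eq_bigr (fun v : 'I_n => 1 + indeg v (n * k))) //.
by rewrite big_split /= H // sum_nat_const card_ord muln1 addn0.
Qed.

Lemma unmarked_weight_mark M u : u < n -> ~~ M u ->
  unmarked_weight (fun x => (x == u) || M x) n + weight u = unmarked_weight M n.
Proof.
move=> lt Mu; rewrite /unmarked_weight [RHS](bigD1 (Ordinal lt)) //= (negPf Mu).
rewrite [X in X + _](bigD1 (Ordinal lt)) //= eqxx add0n addnC; congr (_ + _).
by apply: eq_bigr => i; rewrite -val_eqE /= => /negPf->.
Qed.

Lemma flip_ok (Q : hstate -> nat -> Prop) X s t :
  graph_ok s -> marks s X -> 5 * n + 2 <= t ->
  (forall s' t', graph_ok s' -> reg s' rRes = reg s rRes ->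
     marks s' (fun v => ~~ X v) ->
     (forall u, u < n -> ~~ X u -> exists2 i, i < reg s' rSp & arr s' aStk i = u) ->
     (forall i, i < reg s' rSp -> arr s' aStk i < n /\ ~~ X (arr s' aStk i)) ->
     stack_weight s' (reg s' rSp) + unmarked_weight (fun v => ~~ X v) n = n + n * k ->
     t <= t' + (5 * n + 2) -> Q s' t') ->
  hwp flip Q s t.
Proof.
move=> G mX let_t HQ; apply/wp_seq/wp_bas; first by lia.
(* [v] separates the flipped states from the rest; each state below [v] is by now either stacked or
   unmarked, hence the weight identity. *)
pose J (s' : hstate) t' := exists v, [/\ v <= n, reg s' rV = v & reg s' rT = n - v] /\
   [/\ graph_ok s', reg s' rRes = reg s rRes,
   forall u, u < n -> arr s' aMark u = if u < v then ~~ X u else X u &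
   t <= t' + 5 * v + 1 /\ 5 * (n - v) < t'] /\
   [/\ (forall u, u < v -> ~~ X u -> exists2 i, i < reg s' rSp & arr s' aStk i = u),
     (forall i, i < reg s' rSp -> arr s' aStk i < v /\ ~~ X (arr s' aStk i)) &
     stack_weight s' (reg s' rSp) + unmarked_weight (fun v => ~~ X v) v = \sum_(u < v) weight u].
apply: (wp_while (Inv := J)).
- by move=> s1 t1 [v [_ [[_ _ _ [_ ?]] _]]]; lia.
- move=> s1 t1 [v [[a1 a2 a3] [[G1 b1 b2 b3] [c1 c2 c3]]]] r0.
  have vn : v = n by lia.
  rewrite vn in b2 b3 c1 c2 c3; rewrite sum_weight in c3; apply: HQ => //; last by lia.
  by move=> u lu; rewrite b2 // lu.
- move=> s1 t1 [v [[a1 a2 a3] [[G1 b1 b2 b3] [c1 c2 c3]]]] rN0.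
  have vn : v < n by lia.
  apply/wp_seq/wp_bas; first by lia.
  rewrite /= a2 b2 // ltnn.
  apply/wp_seq/wp_if => /=; first by lia.
    rewrite eqb0 negbK => Xv; apply: wp_bas; first by lia.
    rewrite /= a2 (g_zero G1); apply: wp_bas; first by lia.
    rewrite /= a2 (g_one G1) (g_n G1) addn1.
    exists v.+1; split; first by split.
    split; first (split=> //; last by lia).
    + by apply: same_graph_ok G1.
    + move=> u lu /=; case: eqP => [->|ne]; first by rewrite ltnS leqnn Xv.
      by rewrite b2 // ltnS [u <= v]leq_eqVlt; case: eqP => // /ne.
    split=> /=.
    + move=> u; rewrite ltnS leq_eqVlt => /orP[/eqP->|lt]; first by rewrite Xv.
      exact: c1.
    + by move=> i /c2[h1 h2]; split=> //; apply: ltnW.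
    + rewrite /unmarked_weight !big_ord_recr /= Xv addnA /=.
      by rewrite -/(unmarked_weight (fun v => ~~ X v) v) -c3.
  move/eqP; rewrite eqb0 => Xv; apply: wp_bas; first by lia.
  rewrite /= a2 (g_one G1); apply: wp_bas; first by lia.
  rewrite /= a2 (g_one G1) (g_n G1) !addn1.
  exists v.+1; split; first by split.
  split; first (split=> //; last by lia).
  + by apply: same_graph_ok G1.
  + move=> u lu /=; case: eqP => [->|ne]; first by rewrite ltnS leqnn Xv.
    by rewrite b2 // ltnS [u <= v]leq_eqVlt; case: eqP => // /ne.
  split=> /=.
  + move=> u; rewrite ltnS leq_eqVlt => /orP[/eqP->|lt] Xu.
      by exists (reg s1 rSp); rewrite ?eqxx.
    have [i li Ei] := c1 u lt Xu; exists i; first by apply: ltnW.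
    by rewrite (ltn_eqF li).
  + move=> i; rewrite ltnS leq_eqVlt; case: eqP => [_ _|ne] /=.
      by rewrite ltnS leqnn.
    by move/c2 => [h1 h2]; split=> //; apply: ltnW.
  + rewrite /unmarked_weight /stack_weight !big_ord_recr /= eqxx Xv addn0.
    rewrite -c3 addnAC; congr (_ + _ + _).
    by apply: eq_bigr => i _; rewrite (ltn_eqF (ltn_ord i)).
- exists 0 => /=; rewrite (g_n G) subn0; split; first by split.
  split; first (split=> //; try lia).
    by apply: same_graph_ok G.
  by split=> //; rewrite /stack_weight /unmarked_weight !big_ord0.
Qed.

(** Edges being numbered [q * k + a], the source of [e] is [e %/ k]. *)
Inductive backreach (S : nat -> Prop) : nat -> Prop :=
  | BackSeed u : S u -> backreach S u
  | BackEdge e : e < n * k -> backreach S (tgt e) -> backreach S (e %/ k).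

Lemma last_edge_idem v b : last_edge v (last_edge v b) = last_edge v b.
Proof. by elim: b => //= b IH; case: ifP => //= ->. Qed.

(** For every edge into a marked state, either the target is still stacked, or the edge is still in
    the current list, or the source is marked; at the end the first two are impossible, so the marks
    are closed backwards. The potential [w] drops in every round, and a round costs at most six
    credits. *)
Lemma search_ok (Q : hstate -> nat -> Prop) S s t :
  graph_ok s -> marks s S ->
  (forall u, u < n -> S u -> exists2 i, i < reg s rSp & arr s aStk i = u) ->
  (forall i, i < reg s rSp -> arr s aStk i < n /\ S (arr s aStk i)) ->
  stack_weight s (reg s rSp) + unmarked_weight S n = n + n * k ->
  6 * (n + n * k) + 2 <= t ->
  (forall s' t' M, graph_ok s' -> reg s' rRes = reg s rRes -> marks s' M ->
     (forall u, u < n -> M u <-> backreach (fun x => S x) u) ->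
     t <= t' + (6 * (n + n * k) + 2) -> Q s' t') ->
  hwp search Q s t.
Proof.
move=> G mS stk1 stk2 stkw let_t HQ; apply/wp_seq/wp_bas; first by lia.
(* [last_edge v p = p] says that [p] is empty or an edge into the current state [v], and [indeg v p]
   counts the edges left in its list. Marking a state moves its weight from the unmarked part of [w]
   to the stack. *)
pose J (s' : hstate) t' := exists M v p sp,
   [/\ reg s' rP = p, reg s' rSp = sp, reg s' rT = p + sp, p <= n * k & last_edge v p = p] /\
   [/\ graph_ok s', reg s' rRes = reg s rRes, marks s' M &
     forall i, i < sp -> arr s' aStk i < n /\ M (arr s' aStk i)] /\
   [/\ forall u, u < n -> M u -> backreach (fun x => S x) u, forall u, u < n -> S u -> M u,
     forall e, e < n * k -> M (tgt e) ->
       [\/ exists2 i, i < sp & arr s' aStk i = tgt e, tgt e = v /\ e < p | M (e %/ k)] &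
     p <> 0 -> M v] /\
   let w := indeg v p + stack_weight s' sp + unmarked_weight M n in
   t + 6 * w <= t' + 6 * (n + n * k) + 1 /\ 6 * w < t'.
apply: (wp_while (Inv := J)).
- by move=> s1 t1 [M [v [p [sp [_ [_ [_ /= [_]]]]]]]]; lia.
- move=> s1 t1 [M [v [p [sp [[a1 a2 a3 a4 a5] [[G1 b1 b2 b3] [[c1 c2 c3 c4] [d1 d2]]]]]]]] r0.
  have p0 : p = 0 by lia.
  have sp0 : sp = 0 by lia.
  apply: (HQ _ _ M) => // [u lu|]; last by lia.
  split; first exact: c1.
  move=> br; elim: br lu => [u' Su' lu|e le _ IH _]; first exact: c2.
  have [] := c3 e le (IH (tgt_lt le)) => // [[i]|[_]]; first by rewrite sp0.
  by rewrite p0.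
- move=> s1 t1 [M [v [p [sp [[a1 a2 a3 a4 a5] [[G1 b1 b2 b3] [[c1 c2 c3 c4] [d1 d2]]]]]]]] r0.
  (* A positive potential secures the credits for one more round. *)
  have w_gt0 : 0 < indeg v p + stack_weight s1 sp.
    case: p a3 a5 {a1 a4 c3 c4 d1 d2} => [|e] a3 a5; last first.
      by rewrite /= (tgt_last_edge a5) eqxx.
    case: sp a3 {a2 b3} => [|sp] a3; first by rewrite a3 in r0.
    by rewrite /stack_weight big_ord_recr /= /weight addnS addnS.
  apply/wp_seq/wp_if => //; first by lia.
    rewrite a1 => pN0; case: p a1 a3 a4 a5 c3 c4 d1 d2 pN0 {w_gt0} => // e a1 a3 a4 a5 c3 c4 d1 d2 _.
    have tv : tgt e = v by apply: tgt_last_edge a5.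
    have Mv : M v by apply: c4.
    have un : e %/ k < n by rewrite ltn_divLR.
    move: d1 d2; rewrite /= tv eqxx => d1 d2.
    apply/wp_seq/wp_bas; first by lia.
    rewrite /= a1 (g_src G1) // (g_next G1) // b2 // tv.
    apply/wp_if => /=; first by lia.
      rewrite eqb0 negbK => Mu; apply: wp_bas; first by lia.
      apply: wp_bas; first by lia.
      rewrite /= a2; exists M, v, (last_edge v e), sp.
      split; first by split=> //; [have := last_edge_le v e; lia | apply: last_edge_idem].
      split; first by (split=> //; apply: same_graph_ok G1).
      split; last by rewrite indeg_last_edge /stack_weight /= -/(stack_weight s1 sp); lia.
      split=> //= e' le' Me'; have [||] := c3 e' le' Me'.
      + by constructor 1.
      (* The edge just handled leaves the list, but its source is marked. *)
      + move=> [te]; rewrite ltnS leq_eqVlt => /orP[/eqP->|lt]; first by constructor 3.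
        by constructor 2; split=> //; apply: last_edge_max.
      + by constructor 3.
    move/eqP; rewrite eqb0 => Mu; apply: wp_bas; first by lia.
    rewrite /= a2 (g_one G1) addn1; apply: wp_bas; first by lia.
    rewrite /=; exists (fun x => (x == e %/ k) || M x), v, (last_edge v e), sp.+1.
    split; first by split=> //; [have := last_edge_le v e; lia | apply: last_edge_idem].
    split.
      split=> //=; first by apply: same_graph_ok G1.
      + by move=> x lx /=; case: eqP => //= _; rewrite b2.
      + move=> i; rewrite ltnS leq_eqVlt; case: eqP => [_ _|_ /=]; first by rewrite eqxx.
        by move=> /b3[h1 h2]; rewrite h2 orbT.
    split.
      split=> /=.
      + move=> x lx /orP[/eqP->|]; last exact: c1.
        by apply: BackEdge; rewrite ?tv; [lia | apply: c1 => //; rewrite -tv; apply: tgt_lt].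
      + by move=> x lx Sx; rewrite c2 ?orbT.
      + move=> e' le' /orP[/eqP Et|Me'].
          by constructor 1; exists sp; rewrite ?eqxx.
        have [[i li Ei]|[te]|Mk] := c3 e' le' Me'.
        * by constructor 1; exists i; [apply: ltnW | rewrite (ltn_eqF li)].
        * rewrite ltnS leq_eqVlt => /orP[/eqP->|lt]; first by constructor 3; rewrite eqxx.
          by constructor 2; split=> //; apply: last_edge_max.
        * by constructor 3; rewrite Mk orbT.
      + by move=> _; rewrite Mv orbT.
    have := unmarked_weight_mark un Mu.
    rewrite indeg_last_edge /stack_weight big_ord_recr /= eqxx.
    rewrite (eq_bigr (fun i : 'I_sp => weight (arr s1 aStk i))); last first.
      by move=> i _; rewrite (ltn_eqF (ltn_ord i)).
    by rewrite -/(stack_weight s1 sp); lia.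
  rewrite a1 => p0; rewrite p0 add0n /= in a1 a3 d1 d2.
  rewrite a3 in r0; case: sp {w_gt0} a2 a3 r0 b3 c3 d1 d2 => // sp a2 a3 _ b3 c3 d1 d2.
  have [vn Mv] := b3 sp (leqnn _).
  set v' := arr s1 aStk sp in vn Mv *.
  have w_v' : weight v' = (indeg v' (n * k)).+1 by [].
  rewrite /stack_weight big_ord_recr /= -/v' in d1 d2.
  apply: wp_bas; first by lia.
  rewrite /= a2 (g_one G1) subn1 /= (g_head G1) //.
  apply: wp_bas; first by lia.
  exists M, v', (last_edge v' (n * k)), sp => /=.
  split; first by split; rewrite ?last_edge_le ?last_edge_idem.
  split; first (split=> //; first by apply: same_graph_ok G1).
    by move=> i li; apply: b3; apply: ltnW.
  split.
    split=> // e le Me; have [[i]||] := c3 e le Me.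
    + rewrite ltnS leq_eqVlt => /orP[/eqP->|lt] Ei; last by constructor 1; exists i.
      by constructor 2; split=> //; apply: last_edge_max.
    + by rewrite p0 => -[].
    + by constructor 3.
  rewrite indeg_last_edge /stack_weight /=; lia.
- exists S, 0, 0, (reg s rSp) => /=; split; first by split.
  split; first by (split=> //; apply: same_graph_ok G).
  split; last by rewrite /stack_weight /= -/(stack_weight s (reg s rSp)); lia.
  split=> // [u _ Su|e le Se]; first exact: BackSeed.
  by constructor 1; apply: stk1 => //; apply: tgt_lt.
Qed.

Lemma all_marked_ok (Q : hstate -> nat -> Prop) M s t :
  graph_ok s -> marks s M -> 5 * n + 2 <= t ->
  (forall s' t' b, graph_ok s' -> reg s' rRes = reg s rRes ->
     reg s' rA = nat_of_bool b -> (b <-> forall v, v < n -> M v) ->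
     t <= t' + (5 * n + 2) -> Q s' t') ->
  hwp all_marked Q s t.
Proof.
move=> G mM let_t HQ; apply/wp_seq/wp_bas; first by lia.
pose J (s' : hstate) t' := exists v b, [/\ v <= n, reg s' rV = v & reg s' rT = n - v] /\
   [/\ graph_ok s', reg s' rRes = reg s rRes, marks s' M &
   t <= t' + 5 * v + 1 /\ 5 * (n - v) < t'] /\
   reg s' rA = nat_of_bool b /\ (b <-> forall u, u < v -> M u).
apply: (wp_while (Inv := J)).
- by move=> s1 t1 [v [b [_ [[_ _ _ [_ ?]] _]]]]; lia.
- move=> s1 t1 [v [b [[a1 a2 a3] [[G1 b1 b2 b3] [c1 c2]]]]] r0.
  have vn : v = n by lia.
  by rewrite vn in b3 c2; apply: (HQ _ _ b) => //; lia.
- move=> s1 t1 [v [b [[a1 a2 a3] [[G1 b1 b2 b3] [c1 c2]]]]] rN0.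
  have vn : v < n by lia.
  apply/wp_seq/wp_bas; first by lia.
  rewrite /= a2 b2 //.
  apply/wp_seq/wp_if => /=; first by lia.
    rewrite eqb0 negbK => Mv; apply: wp_bas; first by lia.
    apply: wp_bas; first by lia.
    rewrite /= a2 (g_one G1) (g_n G1) addn1; exists v.+1, b; split; first by split.
    split; first by (split=> //; try lia; apply: same_graph_ok G1).
    split=> //; rewrite c2; split=> H u lu; last by apply: H; apply: ltnW.
    by move: lu; rewrite ltnS leq_eqVlt => /orP[/eqP->|/H].
  move/eqP; rewrite eqb0 => Mv; apply: wp_bas; first by lia.
  apply: wp_bas; first by lia.
  rewrite /= a2 (g_one G1) (g_n G1) addn1; exists v.+1, false; split; first by split.
  split; first by (split=> //; try lia; apply: same_graph_ok G1).
  by split=> //; split=> // /(_ v (leqnn _)); rewrite (negPf Mv).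
- exists 0, true => /=; rewrite (g_n G) subn0; split; first by split.
  by split; first by (split=> //; try lia; apply: same_graph_ok G).
Qed.

(** The inner negated [backreach] says that [u] is [b]-good. *)
Definition good (b : bool) : Prop :=
  forall v, v < n -> backreach (fun u => ~ backreach (fun x => fin x != b) u) v.

(** The budget adds [2 * n + 2] for loading, [5 * n + 2] for each flip and for the final check, and
    [6 * (n + n * k) + 2] for each search. *)
Lemma test_ok b (Q : hstate -> nat -> Prop) s t :
  graph_ok s -> 29 * n + 12 * (n * k) + 12 <= t ->
  (forall s' t' c, graph_ok s' -> reg s' rRes = reg s rRes ->
     reg s' rA = nat_of_bool c -> (c <-> good b) ->
     t <= t' + (29 * n + 12 * (n * k) + 12) -> Q s' t') ->
  hwp (test b) Q s t.
Proof.
move=> G let_t HQ.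
apply/wp_seq/load_marks_ok => //; first by lia.
move=> s1 t1 G1 r1 m1 l1; apply/wp_seq/(flip_ok G1 m1); first by lia.
move=> s2 t2 G2 r2 m2 p2 q2 w2 l2; apply/wp_seq/(search_ok G2 m2 p2 q2 w2); first by lia.
move=> s3 t3 M G3 r3 m3 HM l3; apply/wp_seq/(flip_ok G3 m3); first by lia.
move=> s4 t4 G4 r4 m4 p4 q4 w4 l4; apply/wp_seq/(search_ok G4 m4 p4 q4 w4); first by lia.
move=> s5 t5 M' G5 r5 m5 HM' l5; apply: (all_marked_ok G5 m5); first by lia.
move=> s6 t6 c G6 r6 a6 Hc l6; apply: (HQ _ _ c) => //; [congruence | | lia].
rewrite Hc; split=> H v lv.
  have : backreach (fun x => ~~ M x) v by apply/HM'/H.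
  move=> br; elim: br lv => [u Mu lu|e le _ IH _]; last by apply/BackEdge/IH/tgt_lt.
  by apply: BackSeed => /HM Mu'; rewrite Mu' in Mu.
apply/HM' => //; have br := H v lv; elim: br lv => [u nu lu|e le _ IH _]; last by apply/BackEdge/IH/tgt_lt.
by apply: BackSeed; apply/negP => /HM; apply: contra_not nu; apply.
Qed.

(** The budget is that of [build], of two tests and of two single blocks. *)
Lemma main_ok s t :
  reg s rN = n -> (forall v, v < n -> arr s aIn v = fin v) ->
  (forall e, e < n * k -> arr s aIn (n + e) = tgt e) ->
  (forall v, arr s aHead v = 0) ->
  58 * n + 29 * (n * k) + 28 <= t ->
  hwp (main k) (fun s' _ => reg s' rN = 1 <-> good true \/ good false) s t.
Proof.
move=> sn sfin stgt shead let_t; apply/wp_seq/(build_ok sn sfin stgt shead); first by lia.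
move=> s1 t1 G1 l1; apply/wp_seq/(test_ok (b := true) G1); first by lia.
move=> s2 t2 c G2 r2 a2 Hc l2; apply/wp_seq/wp_bas; first by lia.
rewrite /= (g_zero G2) a2 addn0; apply/wp_seq/test_ok; [|by lia|].
  by case: G2 => *; split.
move=> s3 t3 c' G3; rewrite /= => r3 a3 Hc' l3; apply: wp_bas; first by lia.
rewrite /= r3 a3 (g_one G3) -Hc -Hc'; case: c {Hc a2 r3}; case: c' {Hc' a3} => /=.
all: by split=> [|[]] //; auto.
Qed.

End Algorithm.

(** * Realization on the machine *)

Local Notation rAddr := 13 (only parsing).
Local Notation rBase := 14 (only parsing).

(** The machine cannot multiply, so a product by a constant [j] is unrolled into [j] additions. *)
Lemma iadd_nseq (m : memory) j r a : a != r ->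
  let m' := foldl istep m (nseq j (IAdd r r a)) in
  m' r = m r + j * m a /\ forall x, x != r -> m' x = m x.
Proof.
move=> ne; elim: j m => [|j IH] m /=; first by rewrite addn0.
have [-> H] := IH (upd m r (m r + m a)); rewrite /upd eqxx (negPf ne); split; first lia.
by move=> x nx; rewrite H // /upd (negPf nx).
Qed.

Definition addr_code (A i : nat) : seq instr :=
  IConst rAddr A :: nseq 6 (IAdd rAddr rAddr i) ++ [:: IAdd rAddr rAddr rBase].

Definition hcode1 (i : hinstr) : seq instr :=
  match i with
  | HConst r c => [:: IConst r c]
  | HAdd r a b => [:: IAdd r a b]
  | HSub r a b => [:: ISub r a b]
  | HLoad r A i => rcons (addr_code A i) (ILoad r rAddr)
  | HStore A i r => rcons (addr_code A i) (IStore rAddr r)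
  end.

Definition hcode (b : seq hinstr) : program := flatten (map hcode1 b).

Definition reg_ok (r : nat) : bool := r < rAddr.

Definition hinstr_ok (i : hinstr) : bool :=
  match i with
  | HConst r c => reg_ok r
  | HAdd r a b | HSub r a b => [&& reg_ok r, reg_ok a & reg_ok b]
  | HLoad r A i | HStore A i r => [&& reg_ok r, reg_ok i & A < 6]
  end.

Definition block_ok (b : seq hinstr) : bool :=
  all hinstr_ok b && (size (hcode b) <= 100).

(* The six arrays are interleaved above the base address [B], which makes them
   disjoint without any bound on their lengths. *)
Definition rep (B : nat) (s : hstate) (m : memory) : Prop :=
  [/\ forall r, reg_ok r -> m r = reg s r, m rBase = B &
      forall A i, A < 6 -> m (B + 6 * i + A) = arr s A i].

Lemma addr_code_ok B s m A i : rep B s m -> reg_ok i ->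
  let m' := foldl istep m (addr_code A i) in
  m' rAddr = B + 6 * reg s i + A /\ forall x, x != rAddr -> m' x = m x.
Proof.
move=> [r1 r2 r3] iok; rewrite /addr_code -cat1s !foldl_cat.
have ni : i != rAddr by rewrite ltn_eqF.
have [] := iadd_nseq (upd m rAddr A) 6 ni.
set m1 := foldl _ _ (nseq _ _) => e1 e2 /=; rewrite /upd eqxx; split.
  by rewrite e1 e2 // /upd eqxx (negPf ni) r1 //= r2; lia.
by move=> x nx; rewrite (negPf nx) e2 // /upd (negPf nx).
Qed.

Lemma rep_eq B s m m' : 14 < B -> rep B s m -> (forall x, x != rAddr -> m' x = m x) ->
  rep B s m'.
Proof.
move=> B14 [r1 r2 r3] H; split=> [r rok||A i A6].
- by rewrite H ?r1 // ltn_eqF.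
- by rewrite H.
- by rewrite H ?r3 //; lia.
Qed.

Lemma rep_set_reg B s m r v : 14 < B -> rep B s m -> reg_ok r ->
  rep B (set_reg s r v) (upd m r v).
Proof.
rewrite /reg_ok => B14 [r1 r2 r3] rok; split=> [x xok||A i A6]; rewrite /upd /=.
- rewrite -[Nat.eqb x r]/(x == r); case: eqP => // _; exact: r1.
- by case: eqP => // ?; lia.
- by case: eqP => [?|_]; [lia | apply: r3].
Qed.

Lemma rep_set_arr B s m A i v : 14 < B -> rep B s m -> A < 6 ->
  rep B (set_arr s A i v) (upd m (B + 6 * i + A) v).
Proof.
move=> B14 [r1 r2 r3] A6; split=> [x|| A' j A6']; rewrite /upd /=.
- rewrite /reg_ok => xok; case: eqP => [?|_]; [lia | exact: r1].
- by case: eqP => // ?; lia.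
- rewrite -[Nat.eqb A' A]/(A' == A).
  (* As [A] and [A'] are below six, equal addresses force equal arrays and equal indices. *)
  case: eqP => [E|ne]; first by have -> : A' = A by [lia]; have -> : j = i by [lia]; rewrite !eqxx.
  case: eqP => [E|_]; last exact: r3.
  by case: eqP => [E'|_]; [case: ne; rewrite E E' | apply: r3].
Qed.

Lemma hcode1_ok B s m i : 14 < B -> rep B s m -> hinstr_ok i ->
  rep B (hsem1 s i) (foldl istep m (hcode1 i)).
Proof.
move=> B14 R; have [r1 _ r3] := R; case: i => [r c|r a b|r a b|r A i|A i r]; rewrite /hinstr_ok /hcode1 /hsem1.
- exact: rep_set_reg.
- by move=> /and3P[ok1 ok2 ok3]; rewrite /= !r1 //; apply: rep_set_reg.
- by move=> /and3P[ok1 ok2 ok3]; rewrite /= !r1 //; apply: rep_set_reg.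
- move=> /and3P[ok1 ok2 A6]; have := addr_code_ok A R ok2.
  rewrite foldl_rcons.
  set m' := foldl istep m _ => -[e1 e2] /=.
  rewrite e1 e2 ?r3 //; last by lia.
  by apply: rep_set_reg => //; apply: rep_eq R e2.
- move=> /and3P[ok1 ok2 A6]; have := addr_code_ok A R ok2.
  rewrite foldl_rcons.
  set m' := foldl istep m _ => -[e1 e2] /=.
  rewrite e1 e2 ?r1 //; last by rewrite ltn_eqF.
  by apply: rep_set_arr => //; apply: rep_eq R e2.
Qed.

Lemma hcode_ok B s m b : 14 < B -> rep B s m -> block_ok b ->
  rep B (hsem s b) (foldl istep m (hcode b)).
Proof.
move=> B14 R /andP[ok _]; elim: b s m R ok => //= i b IH s m R /andP[iok ok].
by rewrite /hcode /= foldl_cat; apply: IH => //; apply: hcode1_ok.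
Qed.

Lemma hcode_straight b : all straight (hcode b).
Proof. by elim: b => //= i b; rewrite /hcode /= all_cat => ->; case: i. Qed.

(** A copying loop needs free cells, so cells 2 to 14 are first moved by straight-line code, with
    cell 1 as destination pointer and the stride 6 in cell 2. The loop then uses cells 3 to 6 as
    source pointer, counter, constant one and buffer. *)
Definition relocate (k : nat) : cmd (seq instr) :=
  Seq (Bas (IConst 1 0 :: nseq (k + 18) (IAdd 1 1 0)))
  (Seq (Bas [:: IStore 1 2; IConst 2 6])
  (Seq (Bas (flatten [seq [:: IAdd 1 1 2; IStore 1 x] | x <- iota 3 12]))
  (Seq (Bas [:: IConst 3 15; IConst 4 2])
  (Seq (Bas (nseq k.+1 (IAdd 4 4 0)))
  (Seq (Bas [:: ISub 4 4 3; IConst 5 1])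
  (Seq (While 4 (Bas [:: IAdd 1 1 2; ILoad 6 3; IStore 1 6; IAdd 3 3 5; ISub 4 4 5]))
       (Bas (IConst rBase 0 :: nseq (k + 18) (IAdd rBase rBase 0))))))))).

(** The summand 18 puts the base above the registers however small the automaton is; it also clears
    the end [n * k.+1 + 2] of the input. *)
Lemma base_gt14 n k : 0 < n -> 14 < n * (k + 18).
Proof. nia. Qed.

(** * Correctness of the relocation *)

Section Relocate.

Variables (n k : nat) (inp : memory).
Hypothesis n_gt0 : 0 < n.
Hypothesis inp0 : inp 0 = n.
Let B := n * (k + 18).

(** Cells up to 14 are scratch space and remain unspecified. *)
Definition moved (c : nat) (m : memory) : Prop :=
  (forall i, i < c -> m (B + 6 * i) = inp (i + 2)) /\
  (forall y, 14 < y -> (forall i, i < c -> y != B + 6 * i) -> m y = inp y).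

Lemma moved_eq c m m' : moved c m -> (forall y, 14 < y -> m' y = m y) -> moved c m'.
Proof.
move=> [h1 h2] H; have B14 : 14 < B := base_gt14 k n_gt0; split=> [i lt|y y14 ny]; last by rewrite H ?h2.
by rewrite H ?h1 //; lia.
Qed.

Lemma moved_upd c m : moved c m -> moved c.+1 (upd m (B + 6 * c) (inp (c + 2))).
Proof.
move=> [h1 h2]; split=> [i|y y14 ny]; rewrite /upd.
  rewrite ltnS leq_eqVlt => /orP[/eqP->|lt]; first by rewrite eqxx.
  by case: eqP => [E|_]; [lia | apply: h1].
rewrite (negPf (ny c _)) // h2 // => i lt; apply: ny; lia.
Qed.

Lemma relocate_ok t : 2 * (n * k.+1) + 20 <= t ->
  wp (foldl istep) id (relocate k)
   (fun m _ => [/\ m 0 = n, m rBase = B,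
      forall i, i < n + n * k -> m (B + 6 * i) = inp (i + 2) &
      forall y, B <= y -> (forall i, y != B + 6 * i) -> m y = inp y]) inp t.
Proof.
move=> let_t; have B14 : 14 < B := base_gt14 k n_gt0.
apply/wp_seq/wp_bas; first by lia.
rewrite -[IConst 1 0 :: _]cat1s foldl_cat.
have [|] := @iadd_nseq (foldl istep inp [:: IConst 1 0]) (k + 18) 1 0; first by [].
set m1 := foldl _ _ (nseq _ _); rewrite /= /upd /= inp0 add0n mulnC -/B => b1 f1.
apply/wp_seq/wp_bas; first by lia.
rewrite /= b1 f1 //=; set m2 := upd (upd _ _ _) _ _.
have [a0 a1 a2] : [/\ m2 0 = n, m2 1 = B & m2 2 = 6].
  by rewrite /m2 /upd /= b1 f1 //= inp0; split=> //; case: eqP => // ?; lia.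
have ax x : 2 < x -> x < 15 -> m2 x = inp x.
  move=> x2 x15; rewrite /m2 /upd; case: eqP => [?|_]; first lia.
  case: eqP => [?|_]; first lia.
  by rewrite f1; [case: eqP => // ?; lia | lia].
have mv2 : moved 1 m2.
  have mv0 : moved 0 m1.
    by split=> // y y14 _; rewrite f1; [case: eqP => // ?; lia | lia].
  apply: moved_eq (moved_upd mv0) _ => y y14.
  rewrite /m2 /upd muln0 addn0 add0n; case: (y =P 2) => // ?; lia.
apply/wp_seq/wp_bas; first by lia.
(* [j] cells among 3 to 14 are yet to be moved, so the next is [15 - j], and [13 - j] cells, counted
   from cell 2, are done. *)
have H j m : 3 + j <= 15 -> m 0 = n -> m 1 = B + 6 * (12 - j) -> m 2 = 6 ->
    (forall x, 2 < x -> x < 15 -> m x = inp x) -> moved (13 - j) m -> 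
    let m' := foldl istep m (flatten [seq [:: IAdd 1 1 2; IStore 1 x] | x <- iota (15 - j) j]) in
    [/\ m' 0 = n, m' 1 = B + 6 * 12, m' 2 = 6 & moved 13 m'].
  elim: j m => [|j IH] m lej h0 h1 h2 hx mv; first by rewrite /= h1.
  have -> : iota (15 - j.+1) j.+1 = (15 - j.+1) :: iota (15 - j) j.
    by rewrite /=; congr (_ :: iota _ _); lia.
  rewrite /=; apply: IH; rewrite /upd /=; try lia.
  - by case: eqP => // ?; lia.
  - by case: eqP => [?|_]; lia.
  - by case: eqP => // ?; lia.
  - move=> x x2 x15; case: eqP => [?|_]; first lia.
    by case: eqP => [?|_]; [lia | apply: hx].
  - have -> : 13 - j = (13 - j.+1).+1 by lia.
    apply: moved_eq (moved_upd mv) _ => y y14; rewrite /upd /=.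
    have -> : m 1 + m 2 = B + 6 * (13 - j.+1) by lia.
    case: eqP => // _; last by case: eqP => // ?; lia.
    have -> : (15 - j.+1 == 1) = false by lia.
    by rewrite hx; [congr inp; lia | lia | lia].
have [||||||] := H 12 m2; rewrite ?muln0 ?addn0 //.
set m3 := foldl _ _ (flatten _); move: m3 => m3 d0 d1 d2 mv3.
apply/wp_seq/wp_bas; first by lia.
set m4 := foldl _ _ _.
have [c0 c1 c2] : [/\ m4 0 = n, m4 3 = 15 & m4 4 = 2] by rewrite /m4 /= /upd /= d0.
have {d0 d1 d2 mv3} [d1 d2 mv4] : [/\ m4 1 = B + 6 * 12, m4 2 = 6 & moved 13 m4].
  rewrite /m4 /= /upd /=; split=> //; apply: moved_eq mv3 _ => y y14.
  by case: eqP => [?|_]; [lia | case: eqP => // ?; lia].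
move: m4 c0 c1 c2 d1 d2 mv4 => m4 c0 c1 c2 d1 d2 mv4.
apply/wp_seq/wp_bas; first by lia.
have [|] := @iadd_nseq m4 k.+1 4 0; first by [].
set m5 := foldl _ _ _; move: m5 => m5 e4 f5.
apply/wp_seq/wp_bas; first by lia.
set m6 := foldl _ _ _.
pose J (m : memory) t' := exists x, [/\ m 0 = n, m 1 = B + 6 * (x - 3), m 2 = 6, m 3 = x & m 5 = 1] /\
  [/\ 14 < x, m 4 = n * k.+1 + 2 - x, moved (x - 2) m & 2 * (n * k.+1 + 2 - x) + 2 < t'].
apply/wp_seq; apply: (wp_while (Inv := J)).
- by move=> m t' [x [_ [_ _ _]]]; lia.
- move=> m t' [x [[g0 g1 g2 g3 g5] [x14 g4 mv lt]]] z.
  (* Only an inequality: on a small input the straight-line code has already passed its end, and the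
     truncated counter starts at 0. *)
  have lex : n * k.+1 + 2 <= x by move: z; rewrite /= g4; lia.
  apply: wp_bas; first by lia.
  rewrite -[IConst rBase 0 :: _]cat1s foldl_cat.
  have [|] := @iadd_nseq (foldl istep m [:: IConst rBase 0]) (k + 18) rBase 0; first by [].
  set m7 := foldl _ _ (nseq _ _); rewrite /= /upd /= g0 add0n mulnC -/B => h14 f7.
  have mv7 : moved (x - 2) m7.
    by apply: moved_eq mv _ => y y14; rewrite f7; [case: eqP => // ?; lia | lia].
  split=> //; first by rewrite f7.
    by move=> i lti; apply mv7.1; lia.
  by move=> y yB ny; apply mv7.2 => //; lia.
- move=> m t' [x [[g0 g1 g2 g3 g5] [x14 g4 mv lt]]] z.
  have ltx : x < n * k.+1 + 2 by move: z; rewrite /= g4; lia.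
  (* The source pointer stays below all destinations, so the cell to be read is still intact. *)
  have xB : x < B by rewrite /B; nia.
  have mx : m x = inp x by apply mv.2 => // i _; lia.
  apply: wp_bas; first by lia.
  have E1 : m 1 + m 2 = B + 6 * (x - 2) by lia.
  have ne c : c < 15 -> (c == B + 6 * (x - 2)) = false by lia.
  have x1 : (x == 1) = false by lia.
  set m' := foldl _ _ _.
  have D : [/\ m' 0 = n, m' 1 = B + 6 * (x - 2), m' 2 = 6 & m' 5 = 1] /\
           [/\ m' 3 = x + 1, m' 4 = n * k.+1 + 2 - x - 1 &
           forall y, 14 < y -> m' y = upd m (B + 6 * (x - 2)) (inp (x - 2 + 2)) y].
    rewrite /m' /= /upd /= E1 g0 g2 g3 g4 g5 x1 !ne // mx; split=> //; split=> // y y14.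
    have -> : (y == 1) = false by lia.
    have -> : (y == 3) = false by lia.
    have -> : (y == 4) = false by lia.
    have -> : (y == 6) = false by lia.
    by rewrite subnK //; lia.
  move: D => [[D0 D1 D2 D5] [D3 D4 Dy]]; exists x.+1.
  have -> : x.+1 - 2 = (x - 2).+1 by lia.
  split; first by split=> //; rewrite ?D1 ?D3; lia.
  split; [lia | by rewrite D4; lia | exact: moved_eq (moved_upd mv) Dy | lia].
- have D : [/\ m6 0 = n, m6 1 = B + 6 * 12, m6 2 = 6 & m6 5 = 1] /\
           [/\ m6 3 = 15, m6 4 = n * k.+1 + 2 - 15 & forall y, 14 < y -> m6 y = m4 y].
    rewrite /m6 /= /upd /=; split; first by rewrite !f5.
    split; [by rewrite f5 | by rewrite e4 f5 // c0 c1 c2 mulnC addnC |].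
    move=> y y14; rewrite [m5 y]f5; last by lia.
    by case: eqP => [?|_]; [lia | case: eqP => // ?; lia].
  move: D => [[D0 D1 D2 D5] [D3 D4 Dy]]; exists 15.
  by split; [split | split=> //; [exact: moved_eq mv4 Dy | lia]].
Qed.

End Relocate.

(** * The encoded automaton as a graph *)

Section Encoding.

Variables (k : nat) (D : dfa k).
Hypothesis k_gt0 : 0 < k.
Local Notation n := (nst D).

Definition fin_nat (v : nat) : bool :=
  if insub v : option 'I_n is Some q then dfinal q else false.

Definition tgt_nat (e : nat) : nat := encode D (n + 2 + e).

Lemma fin_natE (q : 'I_n) : fin_nat q = dfinal q.
Proof. by rewrite /fin_nat valK. Qed.

Lemma encode_final v : v < n -> encode D (v + 2) = fin_nat v.
Proof.
move=> lt; rewrite /encode addn2 /= addn2 !ltnS lt subSS subSS subn0 /fin_nat.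
by case: insub.
Qed.

Lemma tgt_natE (q : 'I_n) (a : 'I_k) : tgt_nat (q * k + a) = delta q a.
Proof.
have lt : q * k + a < n * k by have := ltn_ord q; have := ltn_ord a; nia.
rewrite /tgt_nat /encode.
have -> : (n + 2 + (q * k + a) == 0) = false by lia.
have -> : (n + 2 + (q * k + a) == 1) = false by lia.
have -> : (n + 2 + (q * k + a) < n + 2) = false by lia.
have -> : n + 2 + (q * k + a) < n * k + n + 2 by lia.
have -> : n + 2 + (q * k + a) - 2 - n = q * k + a by lia.
by rewrite divnMDl // divn_small // addn0 modnMDl modn_small // !valK.
Qed.

Lemma edgeE e : e < n * k -> exists (q : 'I_n) (a : 'I_k), e = q * k + a.
Proof.
move=> lt; have ltq : e %/ k < n by rewrite ltn_divLR.
exists (Ordinal ltq), (Ordinal (ltn_pmod e k_gt0)); exact: divn_eq.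
Qed.

Lemma tgt_nat_lt e : e < n * k -> tgt_nat e < n.
Proof. by move=> /edgeE[q [a ->]]; rewrite tgt_natE. Qed.

Lemma encode_big x : n * k + n + 2 <= x -> encode D x = 0.
Proof.
move=> le; have n0 : 0 < n by apply: leq_ltn_trans (ltn_ord (dinit D)).
rewrite /encode.
have -> : (x == 0) = false by lia.
have -> : (x == 1) = false by lia.
have -> : (x < n + 2) = false by lia.
by have -> : (x < n * k + n + 2) = false by lia.
Qed.

(** The edge [q * k + a] is the letter [a] read in [q], so a chain of backward edges spells a
    word. *)
Lemma backreachP S (q : 'I_n) :
  backreach n k tgt_nat S q <-> exists w, S (foldl (@delta k D) q w : nat).
Proof.
split=> [br|[w]].
  have [v Ev] : exists v, v = q :> nat by exists q.
  rewrite -Ev in br; elim: br q Ev => [u Su q Eu|e lt _ IH q Eq]; first by exists [::]; rewrite /= -Eu.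
  have [q' [a Ee]] := edgeE lt; rewrite Ee divnMDl // divn_small // addn0 in Eq.
  have [|w Sw] := IH (delta q a); last by exists (a :: w).
  by rewrite Ee (ord_inj Eq) tgt_natE.
elim: w q => [|a w IH] q /= Sw; first exact: BackSeed.
have lt : q * k + a < n * k by have := ltn_ord q; have := ltn_ord a; nia.
have -> : q = (q * k + a) %/ k :> nat by rewrite divnMDl // divn_small // addn0.
by apply: BackEdge => //; rewrite tgt_natE; apply: IH.
Qed.

Lemma goodP b : good n k fin_nat tgt_nat b <->
  forall q, exists w, forall w', dfinal (foldl (@delta k D) (foldl (@delta k D) q w) w') = b.
Proof.
have seedP (q : 'I_n) : ~ backreach n k tgt_nat (fun x => fin_nat x != b) q <->
    forall w, dfinal (foldl (@delta k D) q w) = b.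
  rewrite backreachP; split=> [H w|H [w]]; last by rewrite fin_natE H eqxx.
  by apply/eqP/negPn/negP => ne; apply: H; exists w; rewrite fin_natE.
split=> [H q|H v lt].
  by have /backreachP[w /seedP Hw] := H q (ltn_ord q); exists w.
by apply/(backreachP _ (Ordinal lt)); have [w /seedP Hw] := H (Ordinal lt); exists w.
Qed.

End Encoding.

Theorem theorem8 :
  forall k : nat, 0 < k ->
  exists (P : program) (c : nat),
    forall D : dfa k, accessible D ->
      exists m : memory,
        exec P (c * nst D + c) 0 (encode D) = Some m /\
        (m 0 = 1 <-> zero_one_law D).
Proof.
move=> k k_gt0.
pose p1 := compile id 0 (relocate k); pose p2 := compile hcode (size p1) (main k).
(* Credits are bounded by [(2 * k + 22) * n.+1] for the relocation and [(58 + 29 * k + 28) * n.+1]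
   for the search; a credit is worth [k + 100] steps in the former, whose unrolled products grow
   with [k], and 100 in the latter. *)
exists (p1 ++ p2), ((k + 100) * (2 * k + 22) + 100 * (58 + 29 * k + 28)) => D acc.
set n := nst D; have n_gt0 : 0 < n by apply: leq_ltn_trans (ltn_ord (dinit D)).
have n0 : encode D 0 = n by [].
have [m1 [t1 [ev1 [m1n m1B m1in m1out]]]] := @relocate_ok n k _ n_gt0 n0 _ (leqnn _).
set B := n * (k + 18) in m1B m1in m1out; have B14 : 14 < B := base_gt14 k n_gt0.
have [|||||||m1' [d1 [-> le1 st1]]] := @compile_sim _ _ (foldl istep) id id
  (fun s m => m = s) (fun b => all straight b && (size b <= k + 100)) predT (k + 100)
  _ _ _ _ _ _ _ _ _ _ ev1 (p1 ++ p2) 0 _ _ _ erefl.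
- lia.
- by move=> b /andP[].
- by move=> b /andP[].
- by move=> b s m _ ->.
- by move=> r s m _ ->.
- rewrite /= !all_nseq !size_nseq !orbT /=; lia.
- exact: code_at_catl.
rewrite add0n -/p1 in st1.
pose s0 := HState m1 (fun A i => m1 (B + 6 * i + A)).
have rep0 : rep B s0 m1 by [].
have ev2 := @main_ok n k (@fin_nat k D) (@tgt_nat k D) k_gt0
  (fun e => @tgt_nat_lt k D k_gt0 e) s0 (58 * n + 29 * (n * k) + 28) m1n.
have {ev2} [||||s2 [t2 [ev2 res]]] := ev2 _ _ _ _.
- move=> v lt; rewrite /= addn0 m1in ?encode_final //; lia.
- by move=> e lt; rewrite /= addn0 m1in ?(addnAC n e) // ltn_add2l.
(* The list heads start at zero: they lie beyond the input, in cells that the relocation leaves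
   untouched. *)
- move=> v /=; rewrite m1out; [|lia|move=> i; lia].
  by apply: encode_big; rewrite -/n /B; nia.
- by [].
have [|||||||m2 [d2 [rep2 le2 st2]]] := @compile_sim _ _ hsem reg hcode (rep B)
  block_ok reg_ok 100 _ _ _ _ _ _ _ _ _ _ ev2 (p1 ++ p2) (size p1) m1 _ _ rep0.
- by [].
- by move=> b _; apply: hcode_straight.
- by move=> b /andP[].
- by move=> b s m ok R; apply: hcode_ok.
- by move=> r s m ok [R _ _]; apply: R.
(* The bounds on blocks and registers hold by computation, [k] being a mere operand in [main k]. *)
- by [].
- exact: code_at_catr.
rewrite -/p2 in st2; have {st1 st2} st := steps_trans st1 st2.
(* Generalizing the programs keeps them from being unfolded. *)
move: p1 p2 st => p1 p2 st.
exists m2; split; last first.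
  have [R _ _] := rep2; rewrite R // res !goodP // zero_oneP //.
  by split=> [[]|[[]]] H; [exists true | exists false | left | right].
have [f ->] : exists f, ((k + 100) * (2 * k + 22) + 100 * (58 + 29 * k + 28)) * n +
    ((k + 100) * (2 * k + 22) + 100 * (58 + 29 * k + 28)) = d1 + d2 + f.
  exists (((k + 100) * (2 * k + 22) + 100 * (58 + 29 * k + 28)) * n +
    ((k + 100) * (2 * k + 22) + 100 * (58 + 29 * k + 28)) - (d1 + d2)).
  rewrite subnKC //.
  have b1 : 2 * (n * k.+1) + 20 <= (2 * k + 22) * n.+1 by nia.
  have b2 : 58 * n + 29 * (n * k) + 28 <= (58 + 29 * k + 28) * n.+1 by nia.
  rewrite -mulnSr mulnDl -!mulnA; apply: leq_add.
    by rewrite (leq_trans (leq_trans (leq_addr _ _) le1)) // leq_mul2l b1 orbT.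
  by rewrite (leq_trans (leq_trans (leq_addr _ _) le2)) // leq_mul2l b2 orbT.
by rewrite st exec_end // size_cat.
Qed.
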